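(* Let $X_1,X_2,\ldots$ be i.i.d. random variables with $0\le X_i\le 1$ and mean $\mu\in(0,1)$. Let $\delta\in(0,1)$, $\varepsilon\in(0,\tfrac12)$, let $s$ be a positive integer, let $m_1<m_2<\cdots<m_s$ be positive integers with $m_s\ge \frac{\ln(2s/\delta)}{2\varepsilon^2}$, and let $\mathcal{N}$ be a set of positive integers containing $\{m_1,\ldots,m_s\}$. Let $\overline{X}_n=\frac1n\sum_{i=1}^n X_i$. Let $\mathbf{n}$ be the smallest $n\in\mathcal{N}$ for which there exists $\ell\in\{1,\ldots,s\}$ such that $$\left[\left|\overline{X}_n-\tfrac12\right|-\varepsilon+\frac{n\varepsilon}{3(n\vee m_\ell)}\right]^2\ \ge\ \frac14-\left(\frac{n}{n\vee m_\ell}\right)^2\frac{m_\ell\,\varepsilon^2}{2\ln\frac{2s}{\delta}}.$$ Then $\Pr\{|\overline{X}_{\mathbf n}-\mu|<\varepsilon\}\ge 1-\delta$.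
   Context: $a\vee b$ denotes $\max(a,b)$. The random index $\mathbf n$ is the sample number at termination of the sampling procedure ''continue sampling until the displayed condition holds for some $n\in\mathcal N$ and some $\ell$''. *)

(* Defs.v *)
From HB Require Import structures.
From mathcomp Require Import all_boot all_order all_algebra.
From mathcomp Require Import all_classical all_reals all_analysis.

Set Implicit Arguments.
Unset Strict Implicit.
Unset Printing Implicit Defensive.

Import Order.TTheory GRing.Theory Num.Theory.
Import numFieldNormedType.Exports.

Local Open Scope classical_set_scope.
Local Open Scope ring_scope.

(* Mutual independence: the product rule over every finite subfamily, listed
   by a duplicate-free sequence J of indices. *)
Definition independent_RVs (d : measure_display) (T : measurableType d)
    (R : realType) (P : probability T R) (X : nat -> {RV P >-> R}) : Prop :=
  forall (J : seq nat) (B : nat -> set R), uniq J ->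
    (forall i, measurable (B i)) ->
    P (\bigcap_(i in [set` J]) (X i @^-1` B i)) =
    (\prod_(i <- J) P (X i @^-1` B i))%E.

Definition identically_distributed (d : measure_display) (T : measurableType d)
    (R : realType) (P : probability T R) (X : nat -> {RV P >-> R}) : Prop :=
  forall (i j : nat) (B : set R), measurable B ->
    distribution P (X i) B = distribution P (X j) B.

(* The sequence X_1, X_2, ... is represented by X 0, X 1, ... *)
Definition sample_mean (d : measure_display) (T : measurableType d)
    (R : realType) (P : probability T R) (X : nat -> {RV P >-> R})
    (n : nat) (w : T) : R :=
  (\sum_(i < n) X i w) / n%:R.

(* The condition on the sample number n, the value x of the sample mean and
   the integer k = m_l. *)
Definition stopping_condition (R : realType) (eps delta : R) (s k n : nat)
    (x : R) : Prop :=
  4^-1 - (n%:R / (maxn n k)%:R) ^+ 2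
         * (k%:R * eps ^+ 2 / (2 * ln (2 * s%:R / delta)))
  <= (`|x - 2^-1| - eps + n%:R * eps / (3 * (maxn n k)%:R)) ^+ 2.

Definition stopping_indices (d : measure_display) (T : measurableType d)
    (R : realType) (P : probability T R) (X : nat -> {RV P >-> R})
    (eps delta : R) (s : nat) (m : nat -> nat) (N : set nat) (w : T) :
    set nat :=
  [set n | N n /\ exists2 l : nat, (1 <= l <= s)%N &
     stopping_condition eps delta s (m l) n (sample_mean X n w)].

(* The least element of [stopping_indices], as a total function: [get] returns
   0 when there is none.  That never happens when m_s belongs to N and
   m_s >= ln (2 s / delta) / (2 eps^2), since for n = m_s and l = s the
   left-hand side of [stopping_condition] is then nonpositive. *)
Definition stopping_index (d : measure_display) (T : measurableType d)
    (R : realType) (P : probability T R) (X : nat -> {RV P >-> R})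
    (eps delta : R) (s : nat) (m : nat -> nat) (N : set nat) (w : T) : nat :=
  get [set n | stopping_indices X eps delta s m N w n /\
               forall k, stopping_indices X eps delta s m N w k -> (n <= k)%N].

(* Main.v *)
Require Import Defs.
From HB Require Import structures.
From mathcomp Require Import all_boot all_order all_algebra.
From mathcomp Require Import all_classical all_reals all_analysis.
From mathcomp Require Import measurable_realfun ring lra.
Set Implicit Arguments.
Unset Strict Implicit.
Unset Printing Implicit Defensive.

Import Order.TTheory GRing.Theory Num.Theory.
Import numFieldNormedType.Exports.
Local Open Scope classical_set_scope.
Local Open Scope ring_scope.

(* Sampling stops at the latest at m_s, so an error at termination is an error
   at some pair (n, l) satisfying the stopping condition.  Fix l and put
   k = m_l, L = ln (2 s / delta), r = n / max (n, k), and let x be the sample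
   mean.  If x >= mu + eps and the condition holds at (n, l), then
   eta = r (x - mu) satisfies Massart's condition
   k eta^2 / (2 p (1 - p)) >= L with p = mu + eta / 3, because
   q (1 - q) / (x - q)^2 increases with q.  Such eta form a half-line
   [eta0, 1 - mu], and Massart's lower bound for the Bernoulli rate function at
   eta0 yields a single t >= 0, independent of n and x, with
   n (t x - ln (1 - mu + mu e^t)) >= L.  The products of
   e^(t X_i) / (1 - mu + mu e^t) form a nonnegative supermartingale, so Ville's
   inequality bounds the probability of this event by
   e^(-L) = delta / (2 s).  The case x <= mu - eps follows by replacing X_i with
   1 - X_i, and the union bound over the s values of l gives delta. *)

(** * Massart's bound for the Bernoulli rate function *)

(** Each side splits into two nonnegative factors, and both grow:
    [q' (x - q) - q (x - q') = x (q' - q)] and [(1 - q') (x - q) - (1 - q) (x - q') = (1 - x) (q' -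
    q)]. *)
Lemma bernoulli_var_ratio_le (R : realFieldType) (x q q' : R) :
  0 <= q -> q <= q' -> q' <= x -> x <= 1 ->
  q * (1 - q) * (x - q') ^+ 2 <= q' * (1 - q') * (x - q) ^+ 2.
Proof.
move=> q0 qq' q'x x1.
have -> : q * (1 - q) * (x - q') ^+ 2 = (q * (x - q')) * ((1 - q) * (x - q')).
  by ring.
have -> : q' * (1 - q') * (x - q) ^+ 2 = (q' * (x - q)) * ((1 - q') * (x - q)).
  by ring.
apply: ler_pM; [apply: mulr_ge0; lra|apply: mulr_ge0; lra|nra|nra].
Qed.

(** The points [q] and [q'] lie below [x] at distances [c (x - mu)] and [c eps], so [q <= q']. The
    condition bounds the variance [q' (1 - q')], and monotonicity of the ratio carries the bound
    over to [q = mu + r (x - mu) / 3]. *)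
Lemma stopping_condition_deviation (R : realFieldType) (mu eps L k r x : R) :
  0 < mu -> 0 < eps -> 0 < L -> 0 < r <= 1 -> x <= 1 -> mu + eps <= x ->
  4^-1 - r ^+ 2 * (k * eps ^+ 2 / (2 * L))
    <= (`|x - 2^-1| - eps + r * eps / 3) ^+ 2 ->
  2 * L * ((mu + r * (x - mu) / 3) * (1 - (mu + r * (x - mu) / 3)))
    <= k * (r * (x - mu)) ^+ 2.
Proof.
move=> mu0 eps0 L0 /andP[r0 r1] x1 mux cond.
pose c := 1 - r / 3.
pose q := x - c * (x - mu); pose q' := x - c * eps.
have c0 : 0 < c by rewrite /c; lra.
have -> : mu + r * (x - mu) / 3 = q by rewrite /q /c; field.
have condq' : q' * (1 - q') <= r ^+ 2 * (k * eps ^+ 2 / (2 * L)).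
  (* Dropping the absolute value can only enlarge the square, since [c * eps] is positive. *)
  have /(le_trans cond) : (`|x - 2^-1| - eps + r * eps / 3) ^+ 2
      <= (x - 2^-1 - c * eps) ^+ 2.
    have := ler_norm (x - 2^-1); have := mulr_gt0 c0 eps0.
    have : `|x - 2^-1| ^+ 2 = (x - 2^-1) ^+ 2 by exact: real_normK (num_real _).
    rewrite (_ : r * eps / 3 = eps - c * eps); last by rewrite /c; field.
    move: `|_| (c * eps) => a b; nra.
  by rewrite /q'; nra.
have mono : q * (1 - q) * (x - q') ^+ 2 <= q' * (1 - q') * (x - q) ^+ 2.
  apply: bernoulli_var_ratio_le => //; rewrite /q /q' /c.
  - nra.
  - nra.
  - nra.
have sq0 : 0 < (c * eps) ^+ 2 by rewrite exprn_gt0 ?mulr_gt0.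
rewrite -(ler_pM2r sq0).
have -> : c * eps = x - q' by rewrite /q'; ring.
have step := ler_wpM2r (sqr_ge0 (x - q)) condq'.
have L2 : 0 <= 2 * L by lra.
rewrite -[leLHS]mulrA; apply: le_trans (ler_wpM2l L2 (le_trans mono step)) _.
rewrite le_eqVlt; apply/orP; left; apply/eqP; rewrite /q' /q.
by field; lra.
Qed.

(* The quadratic [Q] is convex and negative at 0, so it is nonnegative on a
   half-line of the positive axis only. *)
Lemma deviation_threshold (R : realType) (mu L k : R) :
  0 < mu < 1 -> 0 < L -> 0 < k ->
  let Q (eta : R) :=
    k * eta ^+ 2 - 2 * L * ((mu + eta / 3) * (1 - (mu + eta / 3))) in
  (forall eta, 0 < eta <= 1 - mu -> Q eta < 0) \/
  exists2 eta0, 0 < eta0 <= 1 - mu /\ Q eta0 = 0 &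
    forall eta, 0 < eta -> 0 <= Q eta -> eta0 <= eta.
Proof.
move=> /andP[mu0 mu1] L0 k0 Q.
have [|/existsNP[eta1 /not_implyP[/andP[eta10 eta11] /negP]]] :=
    pselect (forall eta, 0 < eta <= 1 - mu -> Q eta < 0); first by left.
rewrite -leNgt => Q1; right.
have Q0 : Q 0 < 0.
  have -> : Q 0 = - (2 * (L * (mu * (1 - mu)))) by rewrite /Q; ring.
  by rewrite oppr_lt0 !mulr_gt0 ?subr_gt0.
pose p : {poly R} := k *: 'X^2 - (2 * L) *:
  ((mu%:P + 3^-1 *: 'X) * (1 - (mu%:P + 3^-1 *: 'X))).
have pE e : p.[e] = Q e by rewrite /p !hornerE /Q /=; field.
have [|eta0 /andP[e0 e1] /rootP] := @poly_ivt R p 0 eta1 (ltW eta10).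
  by rewrite !pE (ltW Q0) Q1.
rewrite pE => Qe0.
have eta00 : 0 < eta0.
  rewrite lt0r e0 andbT; apply/eqP => E.
  by move: Q0 Qe0; rewrite E => /lt_eqF/eqP.
exists eta0; first by split => //; lra.
move=> eta eta_gt0 Qeta; rewrite leNgt; apply/negP => lt_eta.
have : eta0 * Q eta < 0; last by rewrite ltNge mulr_ge0 // ltW.
(* Convexity written as an identity: [k + 2 * L / 9] is the leading coefficient of [Q]. *)
have -> : eta0 * Q eta = eta * Q eta0 + (eta0 - eta) * Q 0
   - (k + 2 * L / 9) * (eta * eta0 * (eta0 - eta)).
  by rewrite /Q; field.
rewrite Qe0 mulr0 add0r.
have : 0 < eta * eta0 * (eta0 - eta) by rewrite !mulr_gt0 // subr_gt0.
have : 0 < (eta0 - eta) * - Q 0 by rewrite mulr_gt0 ?subr_gt0 ?oppr_gt0.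
have kL : 0 < k + 2 * L / 9 by lra.
move=> h1 /(mulr_gt0 kL) h2; lra.
Qed.

(** Convexity of [1 / (u (1 - u)) = 1 / u + 1 / (1 - u)]: the gap to the tangent at [p] is
    [(u - p)^2] times a positive quantity. *)
Lemma inv_bernoulli_var_tangent (R : realFieldType) (u p : R) :
  0 < u < 1 -> 0 < p < 1 ->
  (p * (1 - p))^-1 + (2 * p - 1) / (p * (1 - p)) ^+ 2 * (u - p)
    <= (u * (1 - u))^-1.
Proof.
move=> /andP[u0 u1] /andP[p0 p1].
have v0 : 0 < u * (1 - u) by nra.
have w0 : 0 < p * (1 - p) by nra.
rewrite -subr_ge0.
have -> : (u * (1 - u))^-1 -
    ((p * (1 - p))^-1 + (2 * p - 1) / (p * (1 - p)) ^+ 2 * (u - p)) =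
    (u - p) ^+ 2 * ((1 - u) * (1 - p) ^+ 2 + u * p ^+ 2) /
      ((u * (1 - u)) * (p * (1 - p)) ^+ 2).
  by field; lra.
apply: divr_ge0; last by rewrite mulr_ge0 ?sqr_ge0 // ltW.
rewrite mulr_ge0 ?sqr_ge0 // addr_ge0 // mulr_ge0 ?sqr_ge0 // ?ltW //; lra.
Qed.

(* Massart's argument: [d/du] of the divergence of Bernoulli(z) from
   Bernoulli(u) is [- (z - u) / (u (1 - u))], and the density proportional to
   [z - u] on [mu, z] has mean [mu + (z - mu) / 3], so that Jensen's inequality
   applies to the convex function [1 / (u (1 - u))]. *)
Lemma massart_divergence_lower_bound (R : realType) (mu z : R) :
  0 < mu -> mu < z -> z < 1 ->
  (z - mu) ^+ 2 / (2 * ((mu + (z - mu) / 3) * (1 - (mu + (z - mu) / 3)))) <=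
  z * (ln z - ln mu) + (1 - z) * (ln (1 - z) - ln (1 - mu)).
Proof.
move=> mu0 muz z1; set p := mu + _.
have p01 : 0 < p < 1 by rewrite /p; lra.
pose a := (p * (1 - p))^-1.
pose b := (2 * p - 1) / (p * (1 - p)) ^+ 2.
(* The polynomial part is an antiderivative of [- (z - u) (a + b (u - p))], with [a + b (u - p)] the
   tangent of [1 / (u (1 - u))] at [p]. Hence [G] is nondecreasing up to [z], and the claim is
   [G mu <= G z]. *)
pose G u := z * ln u + (1 - z) * ln (1 - u)
  + ((a + b * (z - p)) / 2 * (z - u) ^+ 2 - b / 3 * (z - u) ^+ 3).
pose dG u := (z - u) * ((u * (1 - u))^-1 - (a + b * (u - p))).
have dGE u : u \in `]mu, z[%R -> is_derive u 1 G (dG u).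
  rewrite in_itv /= => /andP[muu uz].
  have u0 : 0 < u by lra.
  have u1 : 0 < 1 - u by lra.
  have := is_derive1_ln u0; have := is_derive1_ln u1 => d1 d2.
  apply: is_derive_eq.
  rewrite /dG /= /GRing.scale /=; field; lra.
have Gcont : {within `[mu, z], continuous G}.
  apply: derivable_within_continuous => u.
  rewrite in_itv /= => /andP[muu uz].
  have u0 : 0 < u by lra.
  have u1 : 0 < 1 - u by lra.
  have := is_derive1_ln u0; have := is_derive1_ln u1 => d1 d2.
  exact: ex_derive.
have [c cmz GE] := MVT muz dGE Gcont.
have : G mu <= G z.
  rewrite -subr_ge0 GE; apply: mulr_ge0; last by lra.
  move: cmz; rewrite in_itv /= => /andP[muc cz].
  rewrite /dG; apply: mulr_ge0; rewrite subr_ge0; first exact: ltW.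
  by apply: inv_bernoulli_var_tangent => //; lra.
have -> : G z = z * ln z + (1 - z) * ln (1 - z) by rewrite /G; ring.
(* The terms in [b] cancel here because [z - p = 2 (z - mu) / 3]; this is why [p] is the right point
   of tangency. *)
have -> : G mu = z * ln mu + (1 - z) * ln (1 - mu)
    + (z - mu) ^+ 2 / (2 * (p * (1 - p))).
  rewrite /G; congr (_ + _).
  have -> : z - p = 2 * (z - mu) / 3 by rewrite /p; field.
  by rewrite /a; clearbody b; field; lra.
lra.
Qed.

(** The left-hand side is [9 (1 - mu) / (4 (2 mu + 1))]. With [q] the fourth root of [mu],
    [- ln mu = - 4 ln q >= 4 (1 - q)], which leaves a polynomial inequality. A square root would
    give only [2 (1 - sqrt mu)], too small near [mu = 0], where the left-hand side tends to 9/4. *)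
Lemma massart_endpoint (R : realType) (mu : R) : 0 < mu < 1 ->
  (1 - mu) ^+ 2 / (2 * ((mu + (1 - mu) / 3) * (1 - (mu + (1 - mu) / 3))))
    < - ln mu.
Proof.
move=> /andP[mu0 mu1].
pose q := Num.sqrt (Num.sqrt mu).
have q0 : 0 < q by rewrite /q !sqrtr_gt0.
have q4 : q ^+ 4 = mu.
  by rewrite (_ : 4%N = (2 * 2)%N) // exprM !sqr_sqrtr ?sqrtr_ge0 // ltW.
have q1 : q < 1.
  by rewrite -(@ltr_pXn2r _ 4) ?nnegrE ?ler01 ?(ltW q0) // q4 expr1n.
have lnq : ln q <= q - 1.
  have := @le_ln1Dx R (q - 1).
  by rewrite (_ : 1 + (q - 1) = q); [apply; lra|ring].
have -> : (1 - mu) ^+ 2 /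
    (2 * ((mu + (1 - mu) / 3) * (1 - (mu + (1 - mu) / 3)))) =
    9 * (1 - mu) / (4 * (2 * mu + 1)) by field; lra.
apply: (@lt_le_trans _ _ (4 * (1 - q))); last first.
  by rewrite -q4 lnXn // -mulr_natl; lra.
rewrite ltr_pdivrMr; last by lra.
(* Subtracting 32 times the first square leaves a quadratic without real roots, whose minimum is
   near 6/10. *)
have pos : 0 < 32 * q ^+ 4 - 9 * q ^+ 3 - 9 * q ^+ 2 - 9 * q + 7.
  have := sqr_ge0 (q ^+ 2 - 9 / 64 * q - 3 / 10).
  have := sqr_ge0 (q - 6 / 10).
  by nra.
rewrite -q4 -subr_gt0.
have -> : 4 * (1 - q) * (4 * (2 * q ^+ 4 + 1)) - 9 * (1 - q ^+ 4) =
   (1 - q) * (32 * q ^+ 4 - 9 * q ^+ 3 - 9 * q ^+ 2 - 9 * q + 7) by ring.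
by rewrite mulr_gt0 // subr_gt0.
Qed.

(* At [eta = 1 - mu] the supremum over [t] is not attained: there the strict
   inequality [massart_endpoint] leaves room for a finite [t]. *)
Lemma massart_tilt (R : realType) (mu eta : R) :
  0 < mu < 1 -> 0 < eta <= 1 - mu ->
  exists2 t, 0 <= t &
    eta ^+ 2 / (2 * ((mu + eta / 3) * (1 - (mu + eta / 3))))
      <= t * (mu + eta) - ln (1 - mu + mu * expR t).
Proof.
move=> mu01 /andP[eta0]; have /andP[mu0 mu1] := mu01.
rewrite le_eqVlt => /orP[/eqP eta1|eta1].
  rewrite {}eta1; set M := (1 - mu) ^+ 2 / _.
  have Mlt : mu < expR (- M).
    rewrite -[ltLHS]lnK ?posrE // ltr_expR ltrNr.
    exact: massart_endpoint.
  have M0 : 0 <= M.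
    rewrite /M divr_ge0 ?sqr_ge0 // mulr_ge0 // mulr_ge0; lra.
  have d0 : 0 < expR (- M) - mu by rewrite subr_gt0.
  have e0 : 0 < (1 - mu) / (expR (- M) - mu) by rewrite divr_gt0 ?subr_gt0.
  (* This [t] solves [t - ln (1 - mu + mu e^t) = M]. *)
  exists (ln ((1 - mu) / (expR (- M) - mu))).
    apply: ln_ge0; rewrite ler_pdivlMr // mul1r lerD2r.
    by rewrite -expR0 ler_expR oppr_le0.
  rewrite lnK ?posrE //.
  have -> : 1 - mu + mu * ((1 - mu) / (expR (- M) - mu)) =
      (1 - mu) / (expR (- M) - mu) * expR (- M) by field; lra.
  move: (_ / _) e0 => e e0.
  by rewrite lnM ?posrE ?expR_gt0 // expRK; lra.
pose z := mu + eta.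
have z0 : 0 < z by rewrite /z; lra.
have z1 : 0 < 1 - z by rewrite /z; lra.
have nmu0 : 0 < 1 - mu by lra.
(* The maximiser of [t z - ln (1 - mu + mu e^t)]; the maximum is the divergence of Bernoulli(z) from
   Bernoulli(mu). *)
exists (ln (z * (1 - mu) / ((1 - z) * mu))).
  apply: ln_ge0; rewrite ler_pdivlMr ?mulr_gt0 // mul1r /z; nra.
rewrite lnK ?posrE ?divr_gt0 ?mulr_gt0 //.
have -> : 1 - mu + mu * (z * (1 - mu) / ((1 - z) * mu)) = (1 - mu) / (1 - z).
  by field; lra.
have := @massart_divergence_lower_bound R mu z mu0.
rewrite !ln_div ?lnM ?posrE ?mulr_gt0 // -/z.
have -> : z - mu = eta by rewrite /z; ring.
move=> /(_ _ _)/le_trans; apply; rewrite /z; lra.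
Qed.

(** The tangent of [exp] at [t x] lies below [exp] at 0 and at [t]; averaging these two bounds with
    weights [1 - x] and [x] cancels the slope. *)
Lemma expR_le_chord (R : realType) (t x : R) : 0 <= x <= 1 ->
  expR (t * x) <= 1 - x + x * expR t.
Proof.
move=> /andP[x0 x1].
have h0 : expR (t * x) * (1 - t * x) <= 1.
  rewrite -[leRHS](expRxMexpNx_1 (t * x)) ler_pM2l ?expR_gt0 //.
  exact: expR_ge1Dx.
have h1 : expR (t * x) * (1 + (t - t * x)) <= expR t.
  have -> : expR t = expR (t * x) * expR (t - t * x).
    by rewrite -expRD; congr expR; ring.
  by rewrite ler_pM2l ?expR_gt0 // expR_ge1Dx.
have := lerD (ler_wpM2l (_ : 0 <= 1 - x) h0) (ler_wpM2l x0 h1).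
rewrite mulr1 subr_ge0 => /(_ x1); apply: le_trans.
by rewrite le_eqVlt; apply/orP; left; apply/eqP; ring.
Qed.

Lemma ln_bernoulli_mgf_ge (R : realType) (mu t : R) : 0 < mu < 1 ->
  t * mu <= ln (1 - mu + mu * expR t).
Proof.
move=> /andP[mu0 mu1]; have et0 := expR_gt0 t.
have pos : 0 < 1 - mu + mu * expR t by nra.
by rewrite -ler_expR lnK ?posrE // expR_le_chord // !ltW.
Qed.

Lemma stopping_condition_tilt (R : realType) (mu eps delta : R) (s k : nat) :
  0 < mu < 1 -> 0 < eps -> 0 < ln (2 * s%:R / delta) -> (0 < k)%N ->
  exists2 t, 0 <= t & forall n x, (0 < n)%N -> x <= 1 -> mu + eps <= x ->
    stopping_condition eps delta s k n x ->
    ln (2 * s%:R / delta) <= n%:R * (t * x - ln (1 - mu + mu * expR t)).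
Proof.
rewrite /stopping_condition; move: (ln (2 * _ / _)) => L.
move=> mu01 eps0 L0 k0; have /andP[mu0 mu1] := mu01.
have kR0 : 0 < k%:R :> R by rewrite ltr0n.
pose r n : R := n%:R / (maxn n k)%:R.
pose Q (eta : R) :=
    k%:R * eta ^+ 2 - 2 * L * ((mu + eta / 3) * (1 - (mu + eta / 3))).
have bad n x : (0 < n)%N -> x <= 1 -> mu + eps <= x ->
    4^-1 - r n ^+ 2 * (k%:R * eps ^+ 2 / (2 * L))
      <= (`|x - 2^-1| - eps + n%:R * eps / (3 * (maxn n k)%:R)) ^+ 2 ->
    0 < r n * (x - mu) <= 1 - mu /\ 0 <= Q (r n * (x - mu)).
  move=> n0 x1 mux cond.
  have M0 : 0 < (maxn n k)%:R :> R by rewrite ltr0n (leq_trans n0) // leq_maxl.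
  have r01 : 0 < r n <= 1.
    apply/andP; split; first by rewrite divr_gt0 // ltr0n.
    by rewrite ler_pdivrMr // mul1r ler_nat leq_maxl.
  have /andP[r0 r1] := r01; split.
    by apply/andP; split; nra.
  rewrite /Q subr_ge0; apply: (@stopping_condition_deviation _ mu eps) => //.
  apply: le_trans cond _.
  by rewrite (_ : r n * eps / 3 = n%:R * eps / (3 * (maxn n k)%:R)) //
    /r; field; lra.
have [Qlt0|[eta0 [eta01 Qeta0] eta0_le]] :=
  @deviation_threshold _ _ _ _ mu01 L0 kR0.
  (* Here the condition never holds together with [mu + eps <= x], so the choice of [t] is
     immaterial. *)
  exists 0 => // n x n0 x1 mux /(bad _ _ n0 x1 mux)[/Qlt0 Qneg].
  by rewrite leNgt Qneg.
have [t t0 tilt] := massart_tilt mu01 eta01.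
exists t => // n x n0 x1 mux /(bad _ _ n0 x1 mux)[/andP[e0 e1] Qe].
have {Qe} le_eta := eta0_le _ e0 Qe.
have psi0 := @ln_bernoulli_mgf_ge _ _ t mu01.
have kL : L <= k%:R * (t * (mu + eta0) - ln (1 - mu + mu * expR t)).
  apply: le_trans (ler_wpM2l (ltW kR0) tilt).
  have p0 : 0 < (mu + eta0 / 3) * (1 - (mu + eta0 / 3)) by nra.
  rewrite [leRHS]mulrA ler_pdivlMr ?mulr_gt0 //; lra.
move: kL psi0; move: (ln _) => phi kL psi0.
have nR0 : 0 < n%:R :> R by rewrite ltr0n.
(* For [n <= k], [k * r n = n] gives [n (x - mu) >= k eta0], while the nonnegative cost [phi - t mu]
   is paid [n] times instead of [k] times. *)
have [nk|kn] := leqP n k.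
  have rE : k%:R * r n = n%:R.
    by rewrite /r (maxn_idPr nk); field; lra.
  have nkR : n%:R <= k%:R :> R by rewrite ler_nat.
  have : k%:R * (t * eta0) <= n%:R * (t * (x - mu)).
    rewrite -rE -mulrA ler_pM2l // mulrCA.
    by rewrite ler_wpM2l.
  have : n%:R * (phi - t * mu) <= k%:R * (phi - t * mu).
    by rewrite ler_wpM2r // subr_ge0.
  lra.
(* For [n > k], [r n = 1] and [x - mu >= eta0]: both the number of factors and the gain per factor
   are at least those in [kL]. *)
have knR : k%:R <= n%:R :> R by rewrite ler_nat ltnW.
have rE : r n = 1 by rewrite /r (maxn_idPl (ltnW kn)) divff ?gt_eqF.
rewrite rE mul1r in le_eta.
have d0 : 0 < t * (mu + eta0) - phi.
  by rewrite -(pmulr_rgt0 _ kR0); lra.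
apply: le_trans kL _; apply: ler_pM => //; first exact: ltW.
have : t * eta0 <= t * (x - mu) by rewrite ler_wpM2l.
lra.
Qed.

(** * Ville's inequality for products of independent factors *)

(** Independence makes the joint law of [(f, g)] the product of the marginal laws; Tonelli's theorem
    then separates the integrals. *)
Lemma integral_mul_indep (d d1 d2 : measure_display) (T : measurableType d)
    (T1 : measurableType d1) (T2 : measurableType d2) (R : realType)
    (P : probability T R) (f : {mfun T >-> T1}) (g : {mfun T >-> T2})
    (u : T1 -> \bar R) (v : T2 -> \bar R) :
  (forall A B, measurable A -> measurable B ->
    P (f @^-1` A `&` g @^-1` B) = (P (f @^-1` A) * P (g @^-1` B))%E) ->
  measurable_fun setT u -> measurable_fun setT v ->
  (forall x, 0 <= u x)%E -> (forall y, 0 <= v y)%E ->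
  (\int[P]_w (u (f w) * v (g w)) = \int[P]_w u (f w) * \int[P]_w v (g w))%E.
Proof.
move=> fg mu_ mv u0 v0.
pose fg_ w := (f w, g w).
have mfg : measurable_fun setT fg_ by exact: measurable_fun_pair.
pose h := mfun_Sub (mem_set mfg).
have hE : h = fg_ :> (T -> _) by [].
pose uv (z : T1 * T2) := (u z.1 * v z.2)%E.
have muv : measurable_fun setT uv.
  by apply: emeasurable_funM;
    [exact: measurableT_comp mu_ _|exact: measurableT_comp mv _].
have uv0 z : (0 <= uv z)%E by rewrite mule_ge0.
transitivity (\int[distribution P h]_z uv z)%E.
  by rewrite ge0_integral_distribution.
transitivity (\int[(distribution P f \x distribution P g)%E]_z uv z)%E.
  apply/esym/eq_measure_integral => A mA _.
  exact: product_measure_unique.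
rewrite fubini_tonelli1 // /fubini_F /uv /=.
under eq_integral => x _.
  rewrite ge0_integralZl //.
  over.
rewrite ge0_integralZr //; last exact: integral_ge0.
by rewrite !ge0_integral_distribution.
Qed.

(* A pi-system generating the sigma-algebra of [X 0, ..., X n.-1]. *)
Definition rectangles (d : measure_display) (T : measurableType d)
    (R : realType) (P : probability T R) (X : nat -> {RV P >-> R}) (n : nat) :
    set (set T) :=
  [set A | exists2 B : nat -> set R, (forall i, measurable (B i)) &
           A = \bigcap_(i in [set` iota 0 n]) (X i @^-1` B i)].

Section rectangles_theory.
Context (d : measure_display) (T : measurableType d) (R : realType).
Variables (P : probability T R) (X : nat -> {RV P >-> R}) (n : nat).

Lemma rectangles_setI : setI_closed (rectangles X n).
Proof.
move=> _ _ [B mB ->] [C mC ->]; exists (fun i => B i `&` C i).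
  by move=> i; exact: measurableI.
by rewrite -bigcapI.
Qed.

Lemma rectangles_measurable : rectangles X n `<=` measurable.
Proof.
move=> _ [B mB ->]; apply: fin_bigcap_measurable => // i _.
by rewrite -[_ @^-1` _]setTI; exact: measurable_funPT.
Qed.

Lemma rectanglesT : rectangles X n setT.
Proof. by exists (fun=> setT) => //; rewrite bigcapT. Qed.

Lemma preimage_rectangles i B : (i < n)%N -> measurable B ->
  rectangles X n (X i @^-1` B).
Proof.
move=> ltin mB; exists (fun j => if j == i then B else setT).
  by move=> j; case: ifP.
apply/seteqP; split => [w Bw j _ /=|w /(_ i)/=].
  by case: eqP => [->|].
by rewrite eqxx mem_iota; apply.
Qed.

Hypothesis Xindep : independent_RVs X.

Lemma rectangles_indep A B : rectangles X n A -> measurable B ->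
  P (A `&` X n @^-1` B) = (P A * P (X n @^-1` B))%E.
Proof.
move=> [C mC ->] mB.
(* Prescribing [B] at coordinate [n] turns the intersection into a product-rule event for the
   indices [n :: iota 0 n]. *)
pose D i := if i == n then B else C i.
have mD i : measurable (D i) by rewrite /D; case: ifP.
have CD : \bigcap_(i in [set` iota 0 n]) (X i @^-1` C i) =
    \bigcap_(i in [set` iota 0 n]) (X i @^-1` D i).
  apply: eq_bigcapr => i /=; rewrite mem_iota /= => ltin.
  by rewrite /D ltn_eqF.
have DnB : D n = B by rewrite /D eqxx.
have un : uniq (n :: iota 0 n) by rewrite /= iota_uniq mem_iota /= ltnn.
have := Xindep un mD; rewrite bigcap_seq !big_cons -bigcap_seq -CD DnB => E.
rewrite setIC E muleC; congr (_ * _)%E.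
by rewrite CD Xindep // iota_uniq.
Qed.

(** With [B] fixed, both sides are finite measures in [A] that agree on a pi-system containing the
    whole space, hence on the sigma-algebra it generates. *)
Lemma sigma_rectangles_indep A B : <<s rectangles X n >> A -> measurable B ->
  P (A `&` X n @^-1` B) = (P A * P (X n @^-1` B))%E.
Proof.
move=> sA mB.
have mD : measurable (X n @^-1` B).
  by rewrite -[_ @^-1` _]setTI; exact: measurable_funPT.
have PD : P (X n @^-1` B) \is a fin_num by exact: fin_num_measure.
pose k : {nonneg R} := NngNum (fine_ge0 (measure_ge0 P (X n @^-1` B))).
have kE C : mscale k P C = (P C * P (X n @^-1` B))%E.
  by rewrite /mscale /= fineK // muleC.
rewrite -kE.
apply: (@g_sigma_algebra_measure_unique _ R T _ rectangles_measurable
  (fun=> setT) (fun=> rectanglesT) _ (mrestr P mD) (mscale k P)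
  rectangles_setI).
- by rewrite bigcup_const //; exists 0%N.
- by move=> C rC; exact: etrans (rectangles_indep rC mB) (esym (kE C)).
- by move=> _; rewrite ltey_eq fin_num_measure.
- by [].
Qed.

Lemma integral_mul_past_next (g : T -> R) (h : R -> R) :
  measurable_fun [set: g_sigma_algebraType (rectangles X n)] g ->
  measurable_fun setT h -> (forall w, 0 <= g w) -> (forall x, 0 <= h x) ->
  (\int[P]_w (g w * h (X n w))%:E =
   \int[P]_w (g w)%:E * \int[P]_w (h (X n w))%:E)%E.
Proof.
move=> mg mh g0 h0.
have mid : measurable_fun [set: T]
    (id : T -> g_sigma_algebraType (rectangles X n)).
  move=> _ A mA; rewrite setTI; move: A mA; apply: smallest_sub.
    exact: sigma_algebra_measurable.
  exact: rectangles_measurable.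
(* The identity, with the past sigma-algebra on its target, plays the role of a random element
   carrying the whole past. *)
pose idm := mfun_Sub (mem_set mid).
have := @integral_mul_indep _ _ _ _ _ _ _ P idm (X n) (EFin \o g) (EFin \o h).
apply.
- by move=> A B mA mB; exact: sigma_rectangles_indep.
- exact/measurable_EFinP.
- exact/measurable_EFinP.
- by move=> w; rewrite lee_fin.
- by move=> w; rewrite lee_fin.
Qed.

End rectangles_theory.

Section ville.
Context (d : measure_display) (T : measurableType d) (R : realType).
Variables (P : probability T R) (X : nat -> {RV P >-> R}).
Hypothesis Xindep : independent_RVs X.
Variable h : R -> R.
Hypotheses (mh : measurable_fun setT h) (h0 : forall x, 0 <= h x).
Hypothesis hle1 : forall i, (\int[P]_w (h (X i w))%:E <= 1)%E.

Let M n w := \prod_(i < n) h (X i w).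

Variables (a : R).
Hypothesis a0 : 0 <= a.

Let crossed n := [set w | exists2 k, (k <= n)%N & a <= M k w].

Let M_ge0 n w : 0 <= M n w.
Proof. by rewrite /M prodr_ge0. Qed.

Let measurable_past n k : (k <= n)%N ->
  measurable_fun [set: g_sigma_algebraType (rectangles X n)] (M k).
Proof.
move=> kn; rewrite /M.
under eq_fun do rewrite -(big_mkord xpredT (fun i => h (X i _))).
apply: measurable_prod => i; rewrite mem_index_iota => /andP[_ ik].
apply: (measurableT_comp mh) => _ B mB; rewrite setTI.
apply: sub_sigma_algebra; apply: preimage_rectangles => //.
exact: leq_trans ik kn.
Qed.

Let measurable_crossed_past n :
  measurable (crossed n : set (g_sigma_algebraType (rectangles X n))).
Proof.
have -> : crossed n =
    \bigcup_(k in `I_n.+1) (M k @^-1` `[a, +oo[%classic).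
  apply/seteqP; split => [w [k kn ak]|w [k kn /=]].
    by exists k => //=; rewrite in_itv /= andbT.
  by rewrite in_itv /= andbT => ak; exists k.
apply: fin_bigcup_measurable => // k /= kn.
by rewrite -[_ @^-1` _]setTI; exact: measurable_past.
Qed.

Let past_measurable n (A : set T) :
  measurable (A : set (g_sigma_algebraType (rectangles X n))) -> measurable A.
Proof.
move: A; apply: smallest_sub; first exact: sigma_algebra_measurable.
exact: rectangles_measurable.
Qed.

Let past_measurable_fun n (f : T -> R) :
  measurable_fun [set: g_sigma_algebraType (rectangles X n)] f ->
  measurable_fun [set: T] f.
Proof.
by move=> mf _ B mB; apply: (@past_measurable n); exact: mf.
Qed.

(* The left-hand side is a lower bound for the mean of the process stopped at
   the first crossing of the level [a]. *)
Let stopped_mean n :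
  (a%:E * P (crossed n) + \int[P]_w (M n w * \1_(~` crossed n) w)%:E <= 1)%E.
Proof.
elim: n => [|n IH].
  have M01 w : M 0 w = 1 by rewrite /M big_ord0.
  have [a1|a1] := leP a 1.
    have -> : crossed 0 = setT.
      by apply/seteqP; split => // w _; exists 0%N => //; rewrite M01.
    rewrite probability_setT mule1 setCT.
    under eq_integral do rewrite indic0 mulr0.
    by rewrite integral0 adde0 lee_fin.
  have -> : crossed 0 = set0.
    apply/seteqP; split => // w [k]; rewrite leqn0 => /eqP ->.
    by rewrite M01 leNgt a1.
  rewrite measure0 mule0 add0e setC0.
  under eq_integral do rewrite indicT mulr1 M01.
  by rewrite integral_cst //= probability_setT mule1.
have mC k : measurable (crossed k).
  by apply: (@past_measurable k); exact: (@measurable_crossed_past k).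
have mM k : measurable_fun setT (M k).
  by apply: (@past_measurable_fun k); exact: (@measurable_past k k).
have CS : crossed n `<=` crossed n.+1.
  by move=> w [k kn ak]; exists k => //; exact: leqW.
(* The event that the level is first reached at time [n.+1]. *)
pose D := crossed n.+1 `\` crossed n.
have mD : measurable D by exact: measurableD.
have -> : P (crossed n.+1) = (P (crossed n) + P D)%E.
  by rewrite -measureU ?setDUK // /D setDE setICA setICr setI0.
rewrite ge0_muleDr // -addeA; apply: le_trans IH; apply: leeD2l.
have -> : (a%:E * P D = \int[P]_w (a * \1_D w)%:E)%E.
  under eq_integral do rewrite EFinM.
  rewrite ge0_integralZl_EFin //; last exact/measurable_EFinP.
  by rewrite integral_indic // setIT.
rewrite -ge0_integralD //; last 4 first.
- by move=> w _; rewrite lee_fin mulr_ge0.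
- by apply/measurable_EFinP; apply: measurable_funM.
- by move=> w _; rewrite lee_fin mulr_ge0.
- apply/measurable_EFinP; apply: measurable_funM => //.
  by apply: measurable_indic; exact: measurableC.
(* Pointwise, off [crossed n] the value [M n.+1] covers [a] on [D] and itself elsewhere; on
   [crossed n] every term vanishes. *)
apply: (@le_trans _ _
  (\int[P]_w (M n w * \1_(~` crossed n) w * h (X n w))%:E)%E).
  apply: ge0_le_integral => //.
  - by move=> w _; rewrite -EFinD lee_fin addr_ge0 // mulr_ge0.
  - apply: emeasurable_funD; apply/measurable_EFinP;
      apply: measurable_funM => //.
    by apply: measurable_indic; exact: measurableC.
  - apply/measurable_EFinP.
    apply: measurable_funM; last exact: measurableT_comp.
    apply: measurable_funM => //.
    by apply: measurable_indic; exact: measurableC.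
  - move=> w _; rewrite -EFinD lee_fin mulrAC.
    have -> : M n w * h (X n w) = M n.+1 w by rewrite /M big_ord_recr.
    rewrite !indicE !in_setC /D in_setD.
    have [Cw|Cw] := boolP (w \in crossed n).
      have -> : w \in crossed n.+1 by apply/mem_set/CS/set_mem.
      by rewrite /= !mulr0 addr0.
    have [|_] := boolP (w \in crossed n.+1); last by rewrite /= mulr0 add0r.
    rewrite /= mulr1 mulr0 addr0 mulr1 inE => -[k kn ak].
    move: kn; rewrite leq_eqVlt => /orP[/eqP <- //|kn].
    by case/negP: Cw; apply/mem_set; exists k.
(* The supermartingale step: the next factor is independent of the past and has mean at most 1. *)
rewrite (@integral_mul_past_next _ _ _ _ _ n Xindep
  (fun w => M n w * \1_(~` crossed n) w) h) //.
- rewrite -[leRHS]mule1 lee_wpmul2l //.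
  by apply: integral_ge0 => w _; rewrite lee_fin mulr_ge0.
- apply: measurable_funM; first exact: (@measurable_past n n).
  apply: measurable_indic; apply: measurableC.
  exact: (@measurable_crossed_past n).
- by move=> w; rewrite mulr_ge0.
Qed.

Lemma measurable_crossing n : measurable
  [set w | exists2 k, (k <= n)%N & a <= \prod_(i < k) h (X i w)].
Proof. by apply: (@past_measurable n); exact: (@measurable_crossed_past n). Qed.

(** A finite horizon is enough for the application, where sampling stops by time [m s]. *)
Lemma ville n :
  (a%:E * P [set w | exists2 k, (k <= n)%N & (a <= \prod_(i < k) h (X i w))%R]
    <= 1)%E.
Proof.
apply: le_trans (stopped_mean n).
by rewrite leeDl // integral_ge0 // => w _; rewrite lee_fin mulr_ge0.
Qed.

End ville.

(** * Deviation at the stopping time *)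

(** The chord bound is affine in [Y], so its mean depends on [mu] alone and equals the normalising
    factor [1 - mu + mu e^t]. *)
Lemma integral_tilt_le1 (d : measure_display) (T : measurableType d)
    (R : realType) (P : probability T R) (Y : T -> R) (mu t : R) :
  measurable_fun setT Y -> (forall w, 0 <= Y w <= 1) ->
  (\int[P]_w (Y w)%:E = mu%:E)%E -> 0 < mu < 1 -> 0 <= t ->
  (\int[P]_w (expR (t * Y w - ln (1 - mu + mu * expR t)))%:E <= 1)%E.
Proof.
move=> mY Y01 EY /andP[mu0 mu1] t0.
have Y0 w : 0 <= Y w by have /andP[] := Y01 w.
have et1 : 1 <= expR t by rewrite -expR0 ler_expR.
have pos : 0 < 1 - mu + mu * expR t by nra.
set phi := ln _.
have ephi : expR (- phi) = (1 - mu + mu * expR t)^-1.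
  by rewrite expRN lnK ?posrE.
pose b := expR (- phi) * (expR t - 1).
have b0 : 0 <= b by rewrite mulr_ge0 ?expR_ge0 // subr_ge0.
apply: (@le_trans _ _ (\int[P]_w ((expR (- phi))%:E + b%:E * (Y w)%:E))%E).
  apply: ge0_le_integral => //.
  - apply/measurable_EFinP; apply: measurableT_comp => //.
    by apply: measurable_funB => //; exact: measurable_funM.
  - apply: emeasurable_funD => //; apply: emeasurable_funM => //.
    exact/measurable_EFinP.
  - move=> w _; rewrite -EFinM -EFinD lee_fin expRD mulrC.
    rewrite /b (_ : _ + _ = expR (- phi) * (1 - Y w + Y w * expR t)).
      by rewrite ler_pM2l ?expR_gt0 // expR_le_chord.
    by ring.
rewrite ge0_integralD //; last 2 first.
- by move=> w _; rewrite -EFinM lee_fin mulr_ge0.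
- by apply: emeasurable_funM => //; exact/measurable_EFinP.
rewrite integral_cst //= probability_setT mule1.
rewrite ge0_integralZl_EFin //; last 2 first.
- by move=> w _; rewrite lee_fin.
- exact/measurable_EFinP.
have total : expR (- phi) + b * mu = 1.
  by rewrite /b ephi; field; rewrite gt_eqF.
by rewrite EY -EFinM -EFinD total.
Qed.

(** The event [A] is a crossing of level [2 s / delta] by the tilted product, chosen before [j], so
    one event serves all sample numbers up to [n]. The function [f] lets the same bound treat both
    tails. *)
Lemma one_sided_bound (d : measure_display) (T : measurableType d)
    (R : realType) (P : probability T R) (X : nat -> {RV P >-> R})
    (f : R -> R) (mu eps delta : R) (s k n : nat) :
  independent_RVs X -> measurable_fun setT f -> (forall x, 0 <= f x <= 1) ->
  (forall i, \int[P]_w (f (X i w))%:E = mu%:E)%E ->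
  0 < mu < 1 -> 0 < eps -> 0 < delta < 1 -> (0 < s)%N -> (0 < k)%N ->
  exists A, [/\ measurable A, (P A <= (delta / (2 * s%:R))%:E)%E &
    forall w j, (0 < j <= n)%N ->
      mu + eps <= (\sum_(i < j) f (X i w)) / j%:R ->
      stopping_condition eps delta s k j ((\sum_(i < j) f (X i w)) / j%:R) ->
      A w].
Proof.
move=> Xindep mf f01 Ef mu01 eps0 /andP[delta0 delta1] s0 k0.
have s1 : 1 <= s%:R :> R by rewrite ler1n.
have a1 : 1 < 2 * s%:R / delta by rewrite ltr_pdivlMr //; lra.
have a0 : 0 < 2 * s%:R / delta by lra.
have [t t0 tilt] := stopping_condition_tilt mu01 eps0 (ln_gt0 a1) k0.
pose h x := expR (t * f x - ln (1 - mu + mu * expR t)).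
have mh : measurable_fun setT h.
  apply: measurableT_comp => //.
  by apply: measurable_funB => //; exact: measurable_funM.
have h0 x : 0 <= h x by exact: expR_ge0.
have hle1 i : (\int[P]_w (h (X i w))%:E <= 1)%E.
  apply: (@integral_tilt_le1 _ _ _ _ (fun w => f (X i w))) => //.
  exact: measurableT_comp.
exists [set w | exists2 j, (j <= n)%N &
  2 * s%:R / delta <= \prod_(i < j) h (X i w)].
split.
- exact: measurable_crossing.
- rewrite -(@lee_pmul2l _ (2 * s%:R / delta)%:E) ?lte_fin //.
  apply: le_trans (ville Xindep mh h0 hle1 (ltW a0) n) _.
  by rewrite -EFinM lee_fin mulrA divfK ?gt_eqF // divff // gt_eqF //; lra.
- move=> w j /andP[j0 jn] mux cond; exists j => //.
  have x1 : (\sum_(i < j) f (X i w)) / j%:R <= 1.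
    rewrite ler_pdivrMr ?ltr0n // mul1r -[leRHS]mulr_natl mulr1.
    rewrite -[X in _ <= X%:R]card_ord -sumr_const.
    by apply: ler_sum => i _; have /andP[] := f01 (X i w).
  have := tilt _ _ j0 x1 mux cond.
  rewrite -ler_expR lnK ?posrE // => /le_trans; apply.
  rewrite -expR_sum ler_expR sumrB -mulr_sumr sumr_const card_ord.
  have jR : j%:R != 0 :> R by rewrite pnatr_eq0 -lt0n.
  move: (ln _) (\sum_(i < j) _) => phi S.
  by rewrite -mulr_natl le_eqVlt; apply/orP; left; apply/eqP; field.
Qed.

(* The observations lie in [0, 1] only almost surely; clipping makes the
   exponential bounds hold everywhere. *)
Definition clip (R : realType) (x : R) : R := Num.max 0 (Num.min x 1).

Lemma clip_bound (R : realType) (x : R) : 0 <= clip x <= 1.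
Proof. by rewrite /clip le_max lexx ge_max ler01 ge_min lexx orbT. Qed.

Lemma clip_id (R : realType) (x : R) : 0 <= x <= 1 -> clip x = x.
Proof.
by move=> /andP[x0 x1]; rewrite /clip (min_idPl x1) (max_idPr x0).
Qed.

Lemma measurable_clip (R : realType) : measurable_fun setT (@clip R).
Proof. by apply: measurable_maxr => //; exact: measurable_minr. Qed.

Lemma two_sided_bound (d : measure_display) (T : measurableType d)
    (R : realType) (P : probability T R) (X : nat -> {RV P >-> R})
    (mu eps delta : R) (s k n : nat) :
  independent_RVs X -> (forall i, {ae P, forall w, 0 <= X i w <= 1}) ->
  (forall i, 'E_P[X i]%E = mu%:E) ->
  0 < mu < 1 -> 0 < eps -> 0 < delta < 1 -> (0 < s)%N -> (0 < k)%N ->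
  exists A, [/\ measurable A, (P A <= (delta / s%:R)%:E)%E &
    forall w j, (forall i, 0 <= X i w <= 1) -> (0 < j <= n)%N ->
      eps <= `|sample_mean X j w - mu| ->
      stopping_condition eps delta s k j (sample_mean X j w) -> A w].
Proof.
move=> Xindep Xbound Xmean mu01 eps0 delta01 s0 k0.
have clip0 (x : R) : 0 <= clip x by have /andP[] := clip_bound x.
have clip1 (x : R) : 0 <= 1 - clip x.
  by rewrite subr_ge0; have /andP[] := clip_bound x.
have mclipX i : measurable_fun setT (fun w => clip (X i w)).
  by apply: measurableT_comp => //; exact: measurable_clip.
have Eclip i : (\int[P]_w (clip (X i w))%:E = mu%:E)%E.
  rewrite -(Xmean i) expectation_def; apply: ae_eq_integral => //.
  - exact/measurable_EFinP.
  - exact/measurable_EFinP.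
  - by apply: filterS (Xbound i) => w Xw _; rewrite clip_id.
have Eflip i : (\int[P]_w (1 - clip (X i w))%:E = (1 - mu)%:E)%E.
  have : (\int[P]_w ((1 - clip (X i w))%:E + (clip (X i w))%:E) = 1)%E.
    under eq_integral do rewrite -EFinD subrK.
    by rewrite integral_cst //= probability_setT mule1.
  rewrite ge0_integralD //; last 4 first.
  - by move=> w _; rewrite lee_fin.
  - by apply/measurable_EFinP; exact: measurable_funB.
  - by move=> w _; rewrite lee_fin.
  - exact/measurable_EFinP.
  rewrite Eclip => /(congr1 (fun x => x - mu%:E)%E).
  by rewrite addeK.
have nmu01 : 0 < 1 - mu < 1.
  by rewrite subr_gt0 gtrBl andbC.
have [A [mA PA Aw]] := @one_sided_bound _ _ _ P X (@clip R) mu eps delta s k n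
  Xindep (@measurable_clip R) (@clip_bound R) Eclip mu01 eps0 delta01 s0 k0.
have flip_bound (x : R) : 0 <= 1 - clip x <= 1.
  by rewrite clip1 gerBl clip0.
have mflip : measurable_fun setT (fun x : R => 1 - clip x).
  by apply: measurable_funB => //; exact: measurable_clip.
have [B [mB PB Bw]] := @one_sided_bound _ _ _ P X (fun x => 1 - clip x)
  (1 - mu) eps delta s k n
  Xindep mflip flip_bound Eflip nmu01 eps0 delta01 s0 k0.
exists (A `|` B); split.
- exact: measurableU.
- apply: le_trans (measureU2 _ mA mB) _; apply: le_trans (leeD PA PB) _.
  have sR : s%:R != 0 :> R by rewrite pnatr_eq0 -lt0n.
  rewrite -EFinD lee_fin le_eqVlt; apply/orP; left; apply/eqP.
  by clear -sR; field.
- move=> w j Xw jn dev cond; have /andP[j0 _] := jn.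
  have jR : j%:R != 0 :> R by rewrite pnatr_eq0 -lt0n.
  have clipE : (\sum_(i < j) clip (X i w)) / j%:R = sample_mean X j w.
    rewrite /sample_mean; congr (_ / _).
    by apply: eq_bigr => i _; rewrite clip_id.
  have flipE : (\sum_(i < j) (1 - clip (X i w))) / j%:R = 1 - sample_mean X j w.
    by rewrite sumrB mulrBl clipE sumr_const card_ord divff.
  move: dev; rewrite ler_normr => /orP[dev|dev].
    by left; apply: (Aw w j jn); rewrite clipE // -lerBrDl.
  right; apply: (Bw w j jn); rewrite flipE.
    by move: dev; clear; lra.
  (* The condition sees [x] only through [|x - 1/2|], so it is invariant under [x -> 1 - x]. *)
  move: cond; rewrite /stopping_condition.
  rewrite (_ : 1 - sample_mean X j w - 2^-1 = - (sample_mean X j w - 2^-1)).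
    by rewrite normrN.
  by move: (sample_mean X j w) => x; field.
Qed.

(** * Existence of the stopping index and measurability of stopped events *)

Section stopping.
Context (d : measure_display) (T : measurableType d) (R : realType).
Variables (P : probability T R) (X : nat -> {RV P >-> R}).
Variables (eps delta : R) (s : nat) (m : nat -> nat) (N : set nat).

Lemma measurable_sample_mean n : measurable_fun setT (sample_mean X n).
Proof.
apply: measurable_funM => //; apply: measurable_sum => i.
exact: measurable_funPT.
Qed.

Lemma measurable_stopping_condition k n :
  measurable [set x | stopping_condition eps delta s k n x].
Proof.
rewrite /stopping_condition; set c := _ - _; set b := _ / _.
pose g (x : R) := (`|x - 2^-1| - eps + b) ^+ 2.
have mg : measurable_fun setT g.
  apply: measurable_funX; apply: measurable_funD => //.
  apply: measurable_funB => //; apply: measurableT_comp => //.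
  exact: measurable_funB.
rewrite (_ : [set _ | _] = g @^-1` `[c, +oo[%classic).
  by rewrite -[_ @^-1` _]setTI; exact: mg.
by apply/seteqP; split => x /=; rewrite in_itv /= andbT.
Qed.

Lemma measurable_stopping_indices n :
  measurable [set w | stopping_indices X eps delta s m N w n].
Proof.
have [Nn|Nn] := pselect (N n); last first.
  by rewrite (_ : [set _ | _] = set0) //; apply/seteqP; split => // w [].
rewrite (_ : [set _ | _] = \bigcup_(l in [set l | (1 <= l <= s)%N])
    (sample_mean X n @^-1` [set x | stopping_condition eps delta s (m l) n x])).
  apply: bigcup_measurable => l _; rewrite -[_ @^-1` _]setTI.
  by apply: measurable_sample_mean => //; exact: measurable_stopping_condition.
apply/seteqP; split => w; first by move=> [_ [l ls cond]]; exists l.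
by move=> [l ls cond]; split => //; exists l.
Qed.

Hypothesis eps0 : 0 < eps.
Hypotheses (L0 : 0 < ln (2 * s%:R / delta)) (s_gt0 : (0 < s)%N).
Hypothesis m_gt0 : (0 < m s)%N.
Hypothesis m_last : ln (2 * s%:R / delta) / (2 * eps ^+ 2) <= (m s)%:R.
Hypothesis N_m : N (m s).

Lemma stopping_indices_last w : stopping_indices X eps delta s m N w (m s).
Proof.
split => //; exists s; first by rewrite s_gt0 leqnn.
rewrite /stopping_condition maxnn; apply: le_trans (sqr_ge0 _).
rewrite divff ?pnatr_eq0 -?lt0n // expr1n mul1r subr_le0.
move: m_last; rewrite ler_pdivrMr; last by rewrite mulr_gt0 // exprn_gt0.
rewrite ler_pdivlMr ?mulr_gt0 //; lra.
Qed.

Lemma stopping_indexP w :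
  stopping_indices X eps delta s m N w (stopping_index X eps delta s m N w) /\
  forall k, stopping_indices X eps delta s m N w k ->
    (stopping_index X eps delta s m N w <= k)%N.
Proof.
apply: (@getPex _ [set n | stopping_indices X eps delta s m N w n /\
  forall k, stopping_indices X eps delta s m N w k -> (n <= k)%N]).
have ex : exists n, `[< stopping_indices X eps delta s m N w n >].
  by exists (m s); apply/asboolP; exact: stopping_indices_last.
have [n /asboolP Sn nmin] := ex_minnP ex.
by exists n; split => // k Sk; apply: nmin; exact/asboolP.
Qed.

(** The event is split by the value [n] of the index, which means that the condition holds at [n]
    and at no earlier time. *)
Lemma measurable_stopped_event (E : nat -> set T) :
  (forall n, measurable (E n)) ->
  measurable [set w | E (stopping_index X eps delta s m N w) w].
Proof.
move=> mE; pose S n := [set w | stopping_indices X eps delta s m N w n].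
rewrite (_ : [set _ | _] =
    \bigcup_n (E n `&` (S n `&` \bigcap_(k in `I_n) ~` S k))).
  apply: bigcup_measurable => n _; apply: measurableI => //.
  apply: measurableI; first exact: measurable_stopping_indices.
  apply: fin_bigcap_measurable => // k _.
  by apply: measurableC; exact: measurable_stopping_indices.
apply/seteqP; split => w /=.
  have [tS tmin] := stopping_indexP w.
  move=> Ew; exists (stopping_index X eps delta s m N w) => //.
  split => //; split => // k /= kt /tmin; by rewrite leqNgt kt.
move=> [n _ [En [Sn nS]]]; have [tS tmin] := stopping_indexP w.
suff -> : stopping_index X eps delta s m N w = n by [].
apply/eqP; rewrite eqn_leq tmin // leqNgt; apply/negP => tn.
exact: nS tn tS.
Qed.

End stopping.

Theorem mainTheorem2 (d : measure_display) (T : measurableType d)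
    (R : realType) (P : probability T R) (X : nat -> {RV P >-> R})
    (mu delta eps : R) (s : nat) (m : nat -> nat) (N : set nat)
    (Xindep : independent_RVs X)
    (Xident : identically_distributed X)
    (Xbound : forall i, {ae P, forall w, 0 <= X i w <= 1})
    (Xmean : forall i, 'E_P[X i]%E = mu%:E)
    (mu01 : 0 < mu < 1)
    (delta01 : 0 < delta < 1)
    (eps012 : 0 < eps < 2^-1)
    (s_gt0 : (0 < s)%N)
    (m_gt0 : forall l, (1 <= l <= s)%N -> (0 < m l)%N)
    (m_incr : forall k l, (1 <= k)%N -> (k < l)%N -> (l <= s)%N ->
       (m k < m l)%N)
    (m_last : ln (2 * s%:R / delta) / (2 * eps ^+ 2) <= (m s)%:R)
    (N_gt0 : forall n, N n -> (0 < n)%N)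
    (N_m : forall l, (1 <= l <= s)%N -> N (m l)) :
  (P [set w | (`|sample_mean X (stopping_index X eps delta s m N w) w - mu|
               < eps)%R] >= (1 - delta)%:E)%E.
Proof.
have /andP[eps0 _] := eps012; have /andP[delta0 delta1] := delta01.
have ss : (1 <= s <= s)%N by rewrite s_gt0 leqnn.
have sR1 : 1 <= s%:R :> R by rewrite ler1n.
have L0 : 0 < ln (2 * s%:R / delta).
  by apply: ln_gt0; rewrite ltr_pdivlMr //; clear -sR1 delta1; lra.
have stopP :=
  stopping_indexP X eps0 L0 s_gt0 (m_gt0 s ss) m_last (N_m s ss).
set G := [set w | _].
have mG : measurable G.
  apply: (@measurable_stopped_event _ _ _ _ _ _ _ _ _ _ eps0 L0 s_gt0
    (m_gt0 s ss) m_last (N_m s ss)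
    (fun n => [set w | `|sample_mean X n w - mu| < eps])) => n.
  pose g w := `|sample_mean X n w - mu|.
  have mg : measurable_fun setT g.
    apply: measurableT_comp => //; apply: measurable_funB => //.
    exact: measurable_sample_mean.
  rewrite (_ : [set _ | _] = g @^-1` `]-oo, eps[%classic).
    by rewrite -[_ @^-1` _]setTI; exact: mg.
  by apply/seteqP; split => w /=; rewrite in_itv.
have [Z [mZ PZ ZX]] := ae_foralln Xbound.
(* Here [l] is shifted to start at 0 and stands for [m l.+1]. Keeping [l < s] under the existential,
   with [set0] as default, lets [choice] pick one event for every natural number. *)
have bad l : exists A : set T, (l < s)%N ->
    [/\ measurable A, (P A <= (delta / s%:R)%:E)%E &
    forall w j, (forall i, 0 <= X i w <= 1) -> (0 < j <= m s)%N ->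
      eps <= `|sample_mean X j w - mu| ->
      stopping_condition eps delta s (m l.+1) j (sample_mean X j w) -> A w].
  have [ls|_] := ltnP l s; last by exists set0.
  have [A AP] := @two_sided_bound _ _ _ P X mu eps delta s (m l.+1) (m s)
    Xindep Xbound Xmean mu01 eps0 delta01 s_gt0 (m_gt0 l.+1 ls).
  by exists A.
have [A AP] := choice bad.
have mA l : (l < s)%N -> measurable (A l) by move=> /AP[].
have mU : measurable (\big[setU/set0]_(l < s) A l).
  by apply: bigsetU_measurable => l _; exact: mA.
have sub : ~` G `<=` Z `|` \big[setU/set0]_(l < s) A l.
  move=> w /negP; rewrite -leNgt => dev.
  have [Xw|Xw] := pselect (forall i, 0 <= X i w <= 1); last by left; apply: ZX.
  right; have [[Nt [l /andP[l1 ls] cond]] tmin] := stopP w.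
  (* Sampling stops by [m s], within the horizon of the events [A]. *)
  have tms := tmin _ (stopping_indices_last X eps0 L0 s_gt0 (m_gt0 s ss)
    m_last (N_m s ss) w).
  have ls' : (l.-1 < s)%N by rewrite prednK.
  rewrite -bigcup_mkord; exists l.-1 => //=.
  have [_ _ /(_ w (stopping_index X eps delta s m N w))] := AP _ ls'.
  by rewrite prednK // N_gt0 // tms; apply.
have PC : (P (~` G) <= delta%:E)%E.
  apply: (@le_trans _ _ (P (Z `|` \big[setU/set0]_(l < s) A l))).
    apply: le_measure; rewrite ?inE //; first exact: measurableC.
    exact: measurableU.
  apply: le_trans (measureU2 _ mZ mU) _; rewrite -[leRHS]add0e.
  apply: leeD; first by rewrite -PZ.
  (* The null set [Z] costs nothing, and each of the [s] events costs [delta / s]. *)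
  apply: le_trans (Boole_inequality P mA) _.
  apply: (@le_trans _ _ (\sum_(l < s) (delta / s%:R)%:E)%E).
    by apply: lee_sum => l _; have [] := AP l (ltn_ord l).
  rewrite sumEFin sumr_const card_ord lee_fin -[leLHS]mulr_natr divfK //.
  by rewrite pnatr_eq0 -lt0n.
have PGC := probability_setC P mG.
have PGfin : P G \is a fin_num by exact: fin_num_measure.
move: PC; rewrite PGC -(fineK PGfin) -EFinB !lee_fin.
by clear; lra.
Qed.
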